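(* Let $\Delta$ be a finite simplicial complex of dimension $d-1$ (with $d\ge 1$), with vertex set $V(\Delta)$ and $h$-polynomial $h(w)$. Then $$h'(w)=\frac{1}{1-w}\left(\sum_{p\in V(\Delta)}h_{\mathrm{lk}_\Delta(p)}(w)-d\,h(w)\right).$$
   Context: For a finite simplicial complex $X$, its $f$-polynomial is $f_X(t)=\sum_{F\in X}t^{|F|}$ (the empty face included). The link of a vertex $p$ of $\Delta$ is $\mathrm{lk}_\Delta(p)=\{G: G\cup\{p\}\in\Delta,\ p\notin G\}$. With $f=f_\Delta$, the $h$-polynomial $h=h_\Delta$ is defined by $(v-1)^d f\!\left(\frac1{v-1}\right)=v^d h\!\left(\frac1v\right)$, equivalently $h(w)=(1-w)^d f\!\left(\frac{w}{1-w}\right)$. The $h$-polynomial of a vertex link is taken with respect to $d-1$: $(v-1)^{d-1}f_{\mathrm{lk}_\Delta(p)}\!\left(\frac1{v-1}\right)=v^{d-1}h_{\mathrm{lk}_\Delta(p)}\!\left(\frac1v\right)$ (this is the usual $h$-polynomial of the link whenever the link has dimension $d-2$, e.g. when $\Delta$ is pure). *)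

(* Defs.v *)
From HB Require Import structures.
From mathcomp Require Import all_boot all_order all_algebra.
Set Implicit Arguments.
Unset Strict Implicit.
Unset Printing Implicit Defensive.
Import GRing.Theory.
Local Open Scope ring_scope.

(* The faces of a complex are finite sets of elements of an ambient finite    *)
(* type T; an element of T need not be a vertex.                              *)

Section Complexes.
Variable T : finType.
Implicit Types (X : {set {set T}}) (F G : {set T}) (p : T).

Definition is_complex X : Prop :=
  set0 \in X /\ forall F G, F \in X -> G \subset F -> G \in X.

Definition vertices X : {set T} := [set p | [set p] \in X].

(* The maximum is taken in nat: this is the dimension as soon as X contains   *)
(* the empty face, with complex_dim [set set0] = -1.                          *)
Definition complex_dim X : int := (\max_(F in X) #|F|)%N%:Z - 1.

Definition link X p : {set {set T}} :=
  [set G : {set T} | (p |: G \in X) && (p \notin G)].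

Definition f_poly X : {poly int} := \sum_(F in X) 'X^#|F|.

End Complexes.

Local Notation ratfun := {fraction {poly int}}.

Definition indet : ratfun := tofrac ('X : {poly int}).

Definition peval (f : {poly int}) (x : ratfun) : ratfun :=
  (map_poly intr f).[x].

(* The defining relation (v-1)^d f_X(1/(v-1)) = v^d h(1/v), an identity of    *)
(* rational functions in the indeterminate v.  By is_h_poly_exists_unique     *)
(* it determines h when all faces of X have at most d elements.               *)
Definition is_h_poly (T : finType) (d : nat) (X : {set {set T}})
    (h : {poly int}) : Prop :=
  let v := indet in
  (v - 1) ^+ d * peval (f_poly X) (1 / (v - 1)) = v ^+ d * peval h (1 / v).

Section WellDefined.
Variable T : finType.
Implicit Types (X : {set {set T}}) (F G : {set T}) (p : T).

Lemma link_is_complex X p :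
  is_complex X -> p \in vertices X -> is_complex (link X p).
Proof.
move=> [_ Xsub]; rewrite inE => Xp; split; first by rewrite !inE setU0 Xp.
move=> F G; rewrite !inE => /andP[XF pF] GF; apply/andP; split.
  exact: Xsub XF (setUS _ GF).
by apply: contra pF; apply: (subsetP GF).
Qed.

Lemma card_face X d F :
  complex_dim X = d%:Z - 1 -> F \in X -> (#|F| <= d)%N.
Proof.
by move=> /addIr[<-] XF; apply: leq_bigmax_cond XF.
Qed.

Lemma card_link_face X d p G :
  complex_dim X = d%:Z - 1 -> G \in link X p -> (#|G| <= d.-1)%N.
Proof.
move=> dimX; rewrite inE => /andP[/(card_face dimX) + pG].
by rewrite cardsU1 pG; case: d {dimX}.
Qed.

Lemma indet_neq0 : indet != 0.
Proof. by rewrite tofrac_eq0 polyX_eq0. Qed.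

Lemma indetB1_neq0 : indet - 1 != 0.
Proof.
rewrite /indet -tofrac1 -tofracB tofrac_eq0.
by rewrite -[1]/(1%:P) polyXsubC_eq0.
Qed.

Lemma peval_indetV_inj (g h : {poly int}) :
  peval g (1 / indet) = peval h (1 / indet) -> g = h.
Proof.
move=> /eqP; rewrite -subr_eq0 /peval -hornerN -hornerD -!rmorphN -rmorphD.
move=> /eqP q0; apply/eqP; rewrite -subr_eq0; move: (g - h) q0 => q q0.
set n := size q.
pose r : {poly int} := \sum_(i < n) q`_i *: 'X^(n - i).
have r0 : r = 0.
  apply/eqP; rewrite -tofrac_eq0; apply/eqP.
  rewrite -[RHS](mulr0 (indet ^+ n)) -q0 horner_poly mulr_sumr rmorph_sum.
  apply: eq_bigr => i _; rewrite -mul_polyC rmorphM /= rmorphXn /=.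
  rewrite -/indet.
  have -> : (tofrac (q`_i)%:P : ratfun) = (q`_i)%:~R.
    by rewrite -[in LHS](intz q`_i) !rmorph_int.
  rewrite mulrCA div1r exprVn; congr (_ * _).
  apply: (canRL (mulfK (expf_neq0 i indet_neq0))).
  by rewrite -exprD subnK // ltnW.
apply/eqP/polyP => i; rewrite coef0.
have [ni|ni] := leqP n i; first by rewrite nth_default.
have /(congr1 (fun s : {poly int} => s`_(n - i))) := r0.
rewrite coef0 coef_sum (bigD1 (Ordinal ni)) //= coefZ coefXn eqxx mulr1.
rewrite big1 ?addr0 // => j ji; rewrite coefZ coefXn.
case: eqP => [e|_]; last by rewrite mulr0.
case/eqP: ji; apply: val_inj => /=.
by rewrite -[LHS](subKn (ltnW (ltn_ord j))) -e subKn // ltnW.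
Qed.

Lemma is_h_poly_exists_unique (d : nat) X :
  (forall F, F \in X -> (#|F| <= d)%N) -> exists! h, is_h_poly d X h.
Proof.
move=> Xd.
set h0 : {poly int} := \sum_(F in X) 'X^#|F| * (1 - 'X) ^+ (d - #|F|).
have h0P : is_h_poly d X h0.
  rewrite /is_h_poly /= /peval /f_poly !rmorph_sum /= !horner_sum !mulr_sumr.
  apply: eq_bigr => F /Xd Fd.
  rewrite rmorphM /= !rmorphXn /= rmorphB rmorph1 /= map_polyX !hornerE /=.
  have cancel_exp (x : ratfun) :
      x != 0 -> x ^+ d * x^-1 ^+ #|F| = x ^+ (d - #|F|).
    move=> x0; rewrite exprVn; apply: (canLR (mulfK (expf_neq0 _ x0))).
    by rewrite -exprD subnK.
  rewrite !cancel_exp ?indetB1_neq0 ?indet_neq0 //.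
  by rewrite -exprMn mulrBr mulr1 divff ?indet_neq0.
exists h0; split=> // h hP; apply: peval_indetV_inj.
by apply: (mulfI (expf_neq0 d indet_neq0)); rewrite -h0P -hP.
Qed.

End WellDefined.

(* Main.v *)
Require Import Defs.
From mathcomp Require Import all_boot all_order all_algebra.
From mathcomp Require Import ring.
Import GRing.Theory.
Local Open Scope ring_scope.

(** Clearing denominators gives the explicit form
    h = \sum_F w^|F| (1 - w)^(d - |F|), and likewise for the links with d - 1.
    Since F |-> F \ p identifies the faces of Delta containing p with the faces
    of the link of p, summing the h-polynomials of the links counts every face F
    exactly |F| times, with weight w^(|F| - 1) (1 - w)^(d - |F|). The identity
    then holds face by face, by the product rule. *)

(** This reduces identities between values at the indeterminate to identities in [{poly int}]. *)
Lemma peval_indet (f : {poly int}) : peval f indet = tofrac f.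
Proof.
rewrite -[in RHS](coefK f) poly_def rmorph_sum /peval horner_poly /=.
apply: eq_bigr => i _; rewrite -mul_polyC rmorphM rmorphXn /=; congr (_ * _).
by rewrite -[in RHS](intz f`_i) !rmorph_int.
Qed.

(** Both sides agree at [1 / indet], and a polynomial is determined by its value there. *)
Lemma is_h_polyE (T : finType) (d : nat) (X : {set {set T}}) (h : {poly int}) :
    (forall F, F \in X -> (#|F| <= d)%N) -> is_h_poly d X h ->
  h = \sum_(F in X) 'X^#|F| * (1 - 'X) ^+ (d - #|F|).
Proof.
move=> Xd hP; apply: peval_indetV_inj.
apply: (mulfI (expf_neq0 d indet_neq0)); rewrite -hP.
rewrite /peval /f_poly !rmorph_sum /= !horner_sum !mulr_sumr.
apply: eq_bigr => F /Xd Fd.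
rewrite rmorphM /= !rmorphXn /= rmorphB rmorph1 /= map_polyX !hornerE /=.
have v0 := negPf indet_neq0; have v1 := negPf indetB1_neq0.
rewrite !exprVn -!expfB_cond ?v0 ?v1 //.
by rewrite -exprMn mulrBr mulr1 divff ?indet_neq0.
Qed.

Lemma sum_link (R : nmodType) (T : finType) (X : {set {set T}}) (g : nat -> R) :
    is_complex X ->
  \sum_(p in vertices X) \sum_(G in link X p) g #|G| =
  \sum_(F in X) g #|F|.-1 *+ #|F|.
Proof.
move=> [_ Xsub].
(* The multiplicity [#|F|] becomes a sum over the points of [F], so the two sums can be
   exchanged. *)
under [RHS]eq_bigr do rewrite -sumr_const.
rewrite (exchange_big_dep (mem (vertices X))) /=; last first.
  by move=> F p XF pF; rewrite inE (Xsub F) // sub1set.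
apply: eq_bigr => p _.
rewrite [RHS](reindex_onto (fun G => p |: G) (fun F => F :\ p)) /=; last first.
  by move=> F /andP[_ pF]; rewrite setD1K.
apply: eq_big => [G | G].
  rewrite !inE eqxx /= andbT; case: (p |: G \in X) => //=.
  (* Adding [p] to [G] and removing it again gives back [G] exactly when [p] is not in [G]. *)
  apply/idP/eqP => [pG | <-]; first by rewrite setU1K.
  by rewrite !inE eqxx.
by rewrite inE => /andP[_ pG]; rewrite cardsU1 pG.
Qed.

(** For [k = 0] the truncated [k.-1] is harmless, as its term is taken [0] times; otherwise
    [d.-1 - k.-1] equals [d - k]. *)
Lemma deriv_face_term (R : comNzRingType) (d k : nat) : (k <= d)%N ->
  (1 - 'X) * ('X^k * (1 - 'X) ^+ (d - k))^`() =
  ('X^(k.-1) * (1 - 'X) ^+ (d.-1 - k.-1)) *+ k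
    - d%:R * ('X^k * (1 - 'X) ^+ (d - k)) :> {poly R}.
Proof.
case: k => [_ | k kd].
  rewrite !expr0 !mul1r !subn0 mulr0n sub0r deriv_exp derivB derivC derivX sub0r.
  case: d => [|d]; first by rewrite !mulr0n mulr0 mul0r oppr0.
  by rewrite -mulr_natl exprS /=; ring.
rewrite derivM derivXn deriv_exp derivB derivC derivX sub0r /=.
(* Exponent zero is treated apart because the derivative of a power lowers its exponent by a
   truncated predecessor. *)
move: (subnK kd); case: (d - k.+1)%N => [|m] <-.
  by rewrite add0n /= subnn !expr0 mulr0n !exprS; ring.
by rewrite addnS /= addnK !exprS; ring.
Qed.

Theorem proposition1p12 (T : finType) (Delta : {set {set T}}) (d : nat)
    (h : {poly int}) (h_lk : T -> {poly int})
    (Delta_complex : is_complex Delta)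
    (d_ge1 : (1 <= d)%N)
    (Delta_dim : complex_dim Delta = d%:Z - 1)
    (h_Delta : is_h_poly d Delta h)
    (h_link : forall p, p \in vertices Delta ->
       is_h_poly d.-1 (link Delta p) (h_lk p)) :
  let w := indet in
  peval h^`() w =
    1 / (1 - w) *
      (\sum_(p in vertices Delta) peval (h_lk p) w - d%:R * peval h w).
Proof.
move=> w.
have faceD F : F \in Delta -> (#|F| <= d)%N by apply: card_face.
have hE := is_h_polyE _ _ _ _ faceD h_Delta.
have key : (1 - 'X) * h^`() = \sum_(p in vertices Delta) h_lk p - d%:R * h.
  under eq_bigr => p Vp.
    rewrite (is_h_polyE _ _ _ _ _ (h_link p Vp)); last first.
      by move=> G; apply: card_link_face.
    over.
  rewrite (sum_link _ _ _ (fun k => 'X^k * (1 - 'X) ^+ (d.-1 - k))) //.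
  rewrite hE raddf_sum !mulr_sumr -sumrB.
  by apply: eq_bigr => F /faceD; apply: deriv_face_term.
have w1 : 1 - w != 0 by rewrite -opprB oppr_eq0 indetB1_neq0.
apply: (mulfI w1); rewrite mulrA div1r mulfV // mul1r.
under eq_bigr do rewrite peval_indet.
have := congr1 (@tofrac {poly int}) key.
rewrite rmorphM rmorphB rmorph1 rmorphB rmorph_sum rmorphM rmorph_nat /=.
by rewrite !peval_indet.
Qed.
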